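(* Let $R(x)=\sum_{i=0}^r u_i x^i\in \mathbb{Z}[x]$ be nonzero and let $(x_k)_{k\ge 1}$ be a sequence of real numbers satisfying $\sum_{i=0}^r u_i x_{k+i}=0$ for all $k\ge 1$. Assume that $x_k=y_k+z_k$ with $z_k\in\mathbb{Z}$ for all $k\ge 1$, such that $(y_k)_{k\ge 1}$ is bounded and $(z_k)_{k\ge 1}$ is not a linear recurrent sequence. Then \[\limsup_{k\to \infty} \lvert y_k\rvert\ge 1/L(R),\] and for any integer $M\ge 1$, there exists an integer $l$ such that \[\limsup_{k\to \infty} y_{kM+l} - \liminf_{k\to \infty} y_{kM+l}\ge 1/\lambda(R).\]
   Context: A linear recurrent sequence is a sequence of real numbers $(w_k)_{k\ge1}$ for which there exist $a_0,\dots,a_d\in\mathbb{Z}$ with $a_d\neq 0$ such that $\sum_{i=0}^d a_iw_{k+i}=0$ for all $k\ge1$ ($a_0=0$ allowed). For $P(x)=\sum_{i=0}^d a_ix^i\in\mathbb{R}[x]$, $L(P)=\sum_i\lvert a_i\rvert$ and $\ell(P)=\inf_Q L(PQ)$, where $Q$ runs through polynomials in $\mathbb{R}[x]$ with leading coefficient $1$ or constant coefficient $1$. For $R\in\mathbb{Z}[x]$, $\lambda(R)=\min_Q \ell(R/Q)$, where $Q$ runs through factors of $R$ in $\mathbb{Z}[x]$ such that every root of $Q$ is either a root of unity or has modulus $<1$, and every root of $Q$ that is a root of unity is simple. *)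

(* Defs.v *)
From HB Require Import structures.
From mathcomp Require Import all_boot all_order all_algebra.
From mathcomp Require Import complex.
From mathcomp Require Import all_classical all_reals all_analysis.

Set Implicit Arguments.
Unset Strict Implicit.
Unset Printing Implicit Defensive.

Import Order.TTheory GRing.Theory Num.Theory.
Import numFieldNormedType.Exports.

Local Open Scope classical_set_scope.
Local Open Scope ring_scope.

(* Sequences [(w_k)_{k >= 1}] are functions on [nat] whose value at index 0 is
   never constrained. *)

(* [sum_i a_i w_{k+i} = 0] for all [k >= 1], where [A = sum_i a_i x^i]. *)
Definition recurrence_by (R : realType) (A : {poly int}) (w : nat -> R) : Prop :=
  forall k : nat, (0 < k)%N -> \sum_(i < size A) (A`_i)%:~R * w (k + i)%N = 0.

(* The coefficients [a_0, ..., a_d] with [a_d != 0] are those of a nonzero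
   integer polynomial of degree [d]. *)
Definition linear_recurrent (R : realType) (w : nat -> R) : Prop :=
  exists2 A : {poly int}, A != 0 & recurrence_by A w.

Definition poly_length (R : realType) (P : {poly R}) : R :=
  \sum_(i < size P) `|P`_i|.

Definition reduced_length (R : realType) (P : {poly R}) : R :=
  inf [set poly_length (P * Q) | Q in [set Q : {poly R} |
    lead_coef Q = 1 \/ Q`_0 = 1]].

Definition root_of_unity (R : realType) (z : R[i]) : Prop :=
  exists2 n : nat, (0 < n)%N & z ^+ n = 1.

Definition admissible (R : realType) (Q : {poly int}) : Prop :=
  forall z : R[i], root (map_poly intr Q) z ->
    (root_of_unity z \/ `|z| < 1) /\
    (root_of_unity z -> mup z (map_poly intr Q) = 1%N).

(* Divisibility is taken in [Z[x]] (mathcomp's [%|] on [{poly int}] is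
   divisibility up to an integer constant), and [S] is the quotient [P / Q].
   A nonzero [P] has finitely many factors in [Z[x]], [Q = 1] being one that is
   admissible, so the infimum below is a minimum. *)
Definition lambda (R : realType) (P : {poly int}) : R :=
  inf [set reduced_length (map_poly intr S : {poly R}) | S in
    [set S : {poly int} | exists2 Q : {poly int}, P = Q * S & admissible R Q]].

(* Main.v *)
(* Write E for the shift and suppose P = Q S with Q admissible, and T monic or of
   constant coefficient 1. The sequence v = S(E) x is annihilated by Q(E), hence, by the
   shape of the roots of Q, it is asymptotically periodic, of some period N that we may
   take divisible by M. The bounded integer sequence g = S(E) z = v - S(E) y is not
   eventually periodic, so there are arbitrarily large k = k' mod N such that the windows
   of g at k and k' differ only at the end where T has coefficient 1. There T(E) g differs
   by at least 1 while T(E) v differs by o(1), so that (S T)(E) y varies by at least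
   1 - o(1) between k and k'; hence 1 <= L(S T) times the largest oscillation of y along
   a residue class mod M. *)
Require Import Defs.
From HB Require Import structures.
From mathcomp Require Import all_boot all_order all_algebra.
From mathcomp Require Import complex.
From mathcomp Require Import all_classical all_reals all_analysis.
From mathcomp Require Import zify ring lra.

Set Implicit Arguments.
Unset Strict Implicit.
Unset Printing Implicit Defensive.

Import Order.TTheory GRing.Theory Num.Theory.
Import numFieldNormedType.Exports.

Local Open Scope classical_set_scope.
Local Open Scope ring_scope.

(** * The action of [p(E)] on sequences, [E] being the shift *)

Definition shift_act (K : comNzRingType) (p : {poly K}) (w : nat -> K) (k : nat) : K :=
  \sum_(i < size p) p`_i * w (k + i)%N.

Section ShiftAct.
Variable K : comNzRingType.
Implicit Types (p q : {poly K}) (w : nat -> K) (k n : nat).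

Lemma shift_act_widen p w k n : (size p <= n)%N ->
  shift_act p w k = \sum_(i < n) p`_i * w (k + i)%N.
Proof.
move=> le_pn; rewrite /shift_act (big_ord_widen n (fun i => p`_i * w (k + i)%N)) //.
rewrite big_mkcond; apply: eq_bigr => i _; case: ltnP => // le_pi.
by rewrite nth_default ?mul0r.
Qed.

Lemma shift_actD p q w k :
  shift_act (p + q) w k = shift_act p w k + shift_act q w k.
Proof.
pose n := maxn (size p) (size q).
rewrite !(@shift_act_widen _ _ _ n) ?leq_maxl ?leq_maxr ?size_polyD // -big_split.
by apply: eq_bigr => i _; rewrite coefD mulrDl.
Qed.

Lemma shift_actC c w k : shift_act c%:P w k = c * w k.
Proof.
by rewrite (@shift_act_widen _ _ _ 1) ?size_polyC_leq1 // big_ord1 coefC addn0.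
Qed.

Lemma shift_actZ c p w k : shift_act (c *: p) w k = c * shift_act p w k.
Proof.
rewrite (@shift_act_widen _ _ _ (size p)) ?size_scale_leq // mulr_sumr.
by apply: eq_bigr => i _; rewrite coefZ mulrA.
Qed.

Lemma shift_actMX p w k : shift_act (p * 'X) w k = shift_act p w k.+1.
Proof.
rewrite (@shift_act_widen _ _ _ (size p).+1); last first.
  by rewrite (leq_trans (size_polyMleq _ _)) // size_polyX addn2.
rewrite big_ord_recl coefMX eqxx mul0r add0r; apply: eq_bigr => i _.
by rewrite coefMX /= addSnnS.
Qed.

(** Sequences thus form a module over polynomials: a factorisation turns into a composition of
    operators. *)
Lemma shift_actM p q w k : shift_act (p * q) w k = shift_act p (shift_act q w) k.
Proof.
elim/poly_ind: p k => [|p c IHp] k.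
  by rewrite mul0r -[0]/(0%:P) !shift_actC !mul0r.
rewrite mulrDl mul_polyC !shift_actD shift_actZ shift_actC shift_actMX -IHp.
by rewrite mulrAC shift_actMX.
Qed.

Lemma shift_actXn n w k : shift_act 'X^n w k = w (k + n)%N.
Proof.
elim: n k => [|n IHn] k; first by rewrite expr0 shift_actC mul1r addn0.
by rewrite exprSr shift_actMX IHn addSnnS.
Qed.

Lemma shift_actB1 n w k :
  shift_act ('X^n - 1) w k = w (k + n)%N - w k.
Proof. by rewrite shift_actD shift_actXn -polyCN shift_actC mulN1r. Qed.

Lemma shift_act_sub p w1 w2 k1 k2 :
  shift_act p w1 k1 - shift_act p w2 k2 =
  \sum_(i < size p) p`_i * (w1 (k1 + i)%N - w2 (k2 + i)%N).
Proof. by rewrite -sumrB; apply: eq_bigr => i _; rewrite mulrBr. Qed.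

Lemma shift_act_seqD p w1 w2 k :
  shift_act p (fun j => w1 j + w2 j) k = shift_act p w1 k + shift_act p w2 k.
Proof. by rewrite -big_split; apply: eq_bigr => i _; rewrite mulrDr. Qed.

Lemma eq_shift_act p w1 w2 k : w1 =1 w2 -> shift_act p w1 k = shift_act p w2 k.
Proof. by move=> e; apply: eq_bigr => i _; rewrite e. Qed.

Lemma shift_act_shift p w n k :
  shift_act p (fun j => w (n + j)%N) k = shift_act p w (n + k).
Proof. by apply: eq_bigr => i _; rewrite addnA. Qed.

End ShiftAct.

Lemma shift_act_map (K L : comNzRingType) (f : {rmorphism K -> L}) (p : {poly K})
    (w : nat -> K) (k : nat) :
  shift_act (map_poly f p) (fun j => f (w j)) k = f (shift_act p w k).
Proof.
rewrite (@shift_act_widen _ _ _ _ (size p)) ?size_poly // rmorph_sum.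
by apply: eq_bigr => i _; rewrite coef_map rmorphM.
Qed.

(** * Pigeonhole and eventual periodicity *)

Section Pigeonhole.
Variables (F : finType) (s : nat -> F).

Lemma pigeonhole_window m :
  exists i p : nat, [/\ (0 < p)%N, (i + p <= #|F|)%N & s (m + i)%N = s (m + i + p)%N].
Proof.
have [/injectiveP inj_s | /injectivePn [i [j neq_ij eq_s]]] :=
    boolP (injectiveb (fun i : 'I_#|F|.+1 => s (m + i)%N)).
  by have := leq_card _ inj_s; rewrite card_ord ltnn.
wlog lt_ij : i j neq_ij eq_s / (i < j)%N => [hw|].
  have [lt_ij | lt_ji | /val_inj eq_ij] := ltngtP i j; first exact: (hw i j).
    by apply: (hw j i) => //; rewrite eq_sym.
  by rewrite eq_ij eqxx in neq_ij.
exists i, (j - i)%N; have := ltn_ord j; split; [lia | lia |].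
by rewrite eq_s; congr s; lia.
Qed.

(** Some value recurs after [K]; as each value determines the next one, all that follows recurs
    too. *)
Lemma eventually_periodic_fwd K :
  (forall k k', (K <= k)%N -> (K <= k')%N -> s k = s k' -> s k.+1 = s k'.+1) ->
  exists2 p, (0 < p)%N & exists K', forall k, (K' <= k)%N -> s (k + p)%N = s k.
Proof.
move=> step; have [i [p [p_gt0 _ eq_s]]] := pigeonhole_window K.
exists p => //; exists (K + i)%N => k /subnKC <-.
elim: (k - _)%N => [|n IHn]; first by rewrite addn0 -eq_s.
by rewrite !addnS addSn; apply: step; rewrite ?IHn //; lia.
Qed.

(* Going backwards from a repetition far away, a period at most [#|F|] holds on
   [K, m]; as there are finitely many candidate periods, one works for all [m]. *)
Lemma eventually_periodic_bwd K :
  (forall k k', (K <= k)%N -> (K <= k')%N -> s k.+1 = s k'.+1 -> s k = s k') ->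
  exists2 p, (0 < p)%N & exists K', forall k, (K' <= k)%N -> s (k + p)%N = s k.
Proof.
move=> step; apply: contrapT => aper.
have {}aper p : (0 < p)%N -> exists k, (K <= k)%N /\ s (k + p)%N <> s k.
  move=> p_gt0; apply: contrapT => per; apply: aper; exists p => //; exists K => k le_Kk.
  by apply: contrapT => neq; apply: per; exists k.
(* [m] lies beyond some failure of each candidate period; a repetition found after [m] will be run
   back to such a failure. *)
have [m bad] : exists m, forall p, (0 < p <= #|F|)%N ->
    exists k, [/\ (K <= k)%N, (k <= m)%N & s (k + p)%N <> s k].
  elim: #|F| => [|n [m IHn]]; first by exists 0%N => p; lia.
  have [//|k [le_Kk neq]] := aper n.+1.
  exists (maxn m k) => p /andP[p_gt0]; rewrite leq_eqVlt => /orP[/eqP ->|lt_pn].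
    by exists k; rewrite leq_maxr.
  have [|k' [? ? ?]] := IHn p; first by rewrite p_gt0.
  by exists k'; split => //; rewrite leq_max; apply/orP; left.
have [i [p [p_gt0 le_pF eq_s]]] := pigeonhole_window m.
have [|k [le_Kk le_km []]] := bad p; first by lia.
have : forall n, (n + K <= m + i)%N -> s (m + i - n)%N = s (m + i + p - n)%N.
  elim=> [|n IHn] le_n; first by rewrite !subn0.
  apply: step; [lia | lia |].
  by rewrite -!subSn; [apply: IHn; lia | lia | lia].
move/(_ (m + i - k)%N) => back; rewrite (_ : (k + p = m + i + p - (m + i - k))%N); last by lia.
by rewrite -back; [congr s; lia | lia].
Qed.

End Pigeonhole.

(* The windows may be made to differ at either end: otherwise the sequence would be
   eventually deterministic, forwards or backwards, hence eventually periodic. *)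
Lemma aperiodic_discrepancy (g : nat -> int) (B N d j K : nat) :
  (0 < N)%N -> (j = 0 \/ j = d)%N -> (forall k, (absz (g k) <= B)%N) ->
  ~ (exists2 p, (0 < p)%N & exists K', forall k, (K' <= k)%N -> g (k + p)%N = g k) ->
  exists k k', [/\ (K <= k)%N, (K <= k')%N, (k = k' %[mod N])%N,
    forall i, (i <= d)%N -> i != j -> g (k + i)%N = g (k' + i)%N &
    g (k + j)%N != g (k' + j)%N].
Proof.
case: N => // N _ jP g_bnd aper; apply: contrapT => none.
have det k k' : (K <= k)%N -> (K <= k')%N -> (k = k' %[mod N.+1])%N ->
    (forall i, (i <= d)%N -> i != j -> g (k + i)%N = g (k' + i)%N) ->
    g (k + j)%N = g (k' + j)%N.
  move=> le_k le_k' mod_kk' win; apply: contrapT => neq; apply: none.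
  by exists k, k'; split => //; apply/eqP.
(* Values lie in [[-B, B]]; adding [B] first makes them nonnegative, so that [absz] loses
   nothing. *)
pose code k : 'I_(B + B).+1 := inord (absz (g k + B%:Z)).
have codeP k k' : code k = code k' -> g k = g k'.
  have := g_bnd k; have := g_bnd k'; move=> b b' /(congr1 val) /=.
  by rewrite !inordK; lia.
(* The finite state records the residue of [k] together with the whole window of length [d + 1]. *)
pose s k : ('I_N.+1 * {ffun 'I_d.+1 -> 'I_(B + B).+1})%type :=
  (inord (k %% N.+1), [ffun i : 'I_d.+1 => code (k + i)%N]).
have sP k k' : s k = s k' <->
    (k = k' %[mod N.+1])%N /\ forall i, (i <= d)%N -> g (k + i)%N = g (k' + i)%N.
  split=> [[/(congr1 val) /= eq_mod /ffunP eq_win]|[eq_mod eq_win]].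
    rewrite !inordK ?ltn_pmod // in eq_mod; split=> // i le_id.
    have := eq_win (inord i); rewrite !ffunE inordK; last by rewrite ltnS.
    exact: codeP.
  rewrite /s eq_mod; congr pair; apply/ffunP => i; rewrite !ffunE /code eq_win //.
  by rewrite -ltnS.
have modS k k' : (k.+1 = k'.+1 %[mod N.+1])%N <-> (k = k' %[mod N.+1])%N.
  have e : (k == k' %[mod N.+1])%N = (k.+1 == k'.+1 %[mod N.+1])%N.
    by rewrite -(eqn_modDr 1) !addn1.
  by split=> /eqP h; apply/eqP; rewrite ?e // -e.
have per_g : (exists2 p, (0 < p)%N & exists K', forall k, (K' <= k)%N -> s (k + p)%N = s k) ->
    exists2 p, (0 < p)%N & exists K', forall k, (K' <= k)%N -> g (k + p)%N = g k.
  case=> p p_gt0 [K' per]; exists p => //; exists K' => k /per /sP[_ /(_ 0%N)].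
  by rewrite !addn0; apply.
(* By [det], the entry at [j] follows from the others. For [j = 0] these lie in the next state,
   which thus determines the current one; for [j = d] the roles are exchanged. *)
case: jP => ej; apply/aper/per_g; subst j.
  apply: (@eventually_periodic_bwd _ _ K) => k k' le_k le_k' /sP[/(modS _ _).1 eq_mod win].
  have {}win i : (i <= d)%N -> i != 0%N -> g (k + i)%N = g (k' + i)%N.
    by case: i => // i lt_id _; rewrite -!addSnnS win // ltnW.
  apply/sP; split=> // -[|i] le_id; last exact: win.
  exact: det.
apply: (@eventually_periodic_fwd _ _ K) => k k' le_k le_k' /sP[/(modS _ _).2 eq_mod win].
apply/sP; split=> // i; rewrite leq_eqVlt => /orP[/eqP ->|lt_id]; last first.
  by rewrite !addSnnS win.
apply: det => //; [exact: leqW | exact: leqW |].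
move=> i' le_i' neq_i'; rewrite !addSnnS win //.
by rewrite ltn_neqAle neq_i'.
Qed.

(** * Annihilated sequences and summable differences *)

Definition abs_summable (K : numDomainType) (w : nat -> K) : Prop :=
  exists B, forall n, \sum_(k < n) `|w k| <= B.

(** Write [w (k + 1) = u k + a * w k] with [u] summable. Summing norms bounds the partial sums of
    [w] by a constant plus [|a|] times themselves, and [|a| < 1] lets the last term be absorbed. *)
Lemma abs_summable_XsubC (K : numFieldType) (a : K) (w : nat -> K) :
  `|a| < 1 -> abs_summable (shift_act ('X - a%:P) w) -> abs_summable w.
Proof.
move=> a_lt1 [B leB]; exists ((`|w 0%N| + B) / (1 - `|a|)) => n.
rewrite ler_pdivlMr ?subr_gt0 // mulrBr mulr1 lerBlDr.
have le_n : \sum_(k < n) `|w k| <= \sum_(k < n.+1) `|w k|.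
  by rewrite big_ord_recr /= lerDl.
apply: le_trans le_n _; rewrite big_ord_recl -addrA lerD2l.
apply: le_trans (lerD (leB n) (lexx _)); rewrite mulr_suml -big_split /=.
apply: ler_sum => k _; rewrite -normrM.
have -> : w (bump 0 k) = shift_act ('X - a%:P) w k + w k * a.
  by rewrite shift_actD -polyCN shift_actC -['X]expr1 shift_actXn addn1 mulNr mulrC subrK.
exact: ler_normD.
Qed.

Lemma abs_summable_prod_XsubC (K : numFieldType) (rs : seq K) (w : nat -> K) :
  (forall a, a \in rs -> `|a| < 1) ->
  abs_summable (shift_act (\prod_(a <- rs) ('X - a%:P)) w) -> abs_summable w.
Proof.
elim: rs w => [|a rs IHrs] w small.
  rewrite big_nil => -[B leB]; exists B => n; apply: le_trans (leB n).
  by apply: ler_sum => k _; rewrite shift_actC mul1r.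
rewrite big_cons mulrC => -[B leB]; apply: (@abs_summable_XsubC _ a).
  by apply: small; rewrite mem_head.
apply: IHrs => [b b_rs|]; first by apply: small; rewrite inE b_rs orbT.
exists B => n; apply: le_trans (leB n).
by apply: ler_sum => k _; rewrite shift_actM.
Qed.

(* The simple roots with [a ^+ N = 1] all lie in ['X^N - 1], so that the other
   roots alone annihilate the differences of step [N]. *)
Lemma annihilated_abs_summable (C : numClosedFieldType) (Q : {poly C}) (N : nat)
    (w : nat -> C) :
  Q != 0 ->
  (forall a, root Q a -> (a ^+ N = 1 -> mup a Q = 1%N) /\ (a ^+ N = 1 \/ `|a| < 1)) ->
  (forall k, shift_act Q w k = 0) ->
  abs_summable (fun k => w (k + N)%N - w k).
Proof.
move=> Q_neq0 rootsQ annQ; have [rs defQ] := closed_field_poly_normal Q.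
have c_neq0 : lead_coef Q != 0 by rewrite lead_coef_eq0.
have mem_rs a : (a \in rs) = root Q a.
  by rewrite defQ rootZ // root_prod_XsubC.
pose unity (a : C) := a ^+ N == 1.
have uniq_unity : uniq [seq a <- rs | unity a].
  apply: count_mem_uniq => a; rewrite mem_filter mem_rs count_filter.
  have [a1|/negbTE an1] := boolP (unity a); last first.
    apply/eqP; rewrite /= -leqn0 leqNgt -has_count; apply/hasPn => b _ /=.
    by case: eqP => // ->; rewrite an1.
  rewrite (@eq_count _ _ (pred1 a)); last by move=> b /=; case: eqP => // ->.
  case: (boolP (root Q a)) => [Qa|nQa]; last by apply/count_memPn; rewrite mem_rs.
  have [/(_ (eqP a1)) mup_a _] := rootsQ a Qa; rewrite -[RHS]/1%N -mup_a.
  by rewrite [in RHS]defQ -mul_polyC mupMr ?rootC // mu_prod_XsubC.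
have /dvdpP[q defq] : \prod_(a <- [seq a <- rs | unity a]) ('X - a%:P) %| 'X^N - 1.
  apply: uniq_roots_dvdp; last by rewrite uniq_rootsE.
  apply/allP => a; rewrite mem_filter => /andP[/eqP a1 _].
  by rewrite /root !hornerE a1 subrr.
apply: (@abs_summable_prod_XsubC _ [seq a <- rs | ~~ unity a]) => [a|].
  rewrite mem_filter mem_rs => /andP[/negP a1 /rootsQ[_ []]] //.
  by move=> /eqP.
exists 0 => n; rewrite big1 // => k _; apply/eqP; rewrite normr_eq0; apply/eqP.
(* The non-unity factors times ['X^N - 1] give a multiple of [Q], so the sequence to be summed
   vanishes and the bound 0 serves. *)
rewrite (@eq_shift_act _ _ _ (shift_act ('X^N - 1) w)); last first.
  by move=> j; rewrite shift_actB1.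
rewrite -shift_actM defq mulrCA [X in q * X]mulrC.
rewrite (_ : \prod_(a <- _) _ * \prod_(a <- _) _ = \prod_(a <- rs) ('X - a%:P)); last first.
  by rewrite !big_filter [RHS](bigID unity).
have -> : \prod_(a <- rs) ('X - a%:P) = (lead_coef Q)^-1 *: Q.
  by rewrite {2}defQ scalerA mulVf // scale1r.
rewrite -scalerAr shift_actZ shift_actM (@eq_shift_act _ _ _ (fun=> 0)) //.
by rewrite /shift_act big1 ?mulr0 // => i _; rewrite mulr0.
Qed.

Lemma common_unity_exponent (R : realType) (M : nat) (rs : seq R[i]) :
  (0 < M)%N -> exists N, [/\ (0 < N)%N, (M %| N)%N &
    forall a, a \in rs -> Defs.root_of_unity a -> a ^+ N = 1].
Proof.
move=> M_gt0; elim: rs => [|a rs [N [N_gt0 dvd_MN IHN]]]; first by exists M.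
have [[n n_gt0 an1]|not_unity] := pselect (Defs.root_of_unity a).
  exists (n * N)%N; split; [by rewrite muln_gt0 n_gt0 | exact: dvdn_mull |].
  move=> b; rewrite inE => /predU1P[->|b_rs] ub; first by rewrite exprM an1 expr1n.
  by rewrite mulnC exprM IHN // expr1n.
by exists N; split => // b; rewrite inE => /predU1P[-> //|]; apply: IHN.
Qed.

(** [N] is a common multiple of [M] and of exponents killing the roots of unity among the roots of
    [Q]. These roots are complex, so the sequence is carried to [R[i]] and the bound brought
    back. *)
Lemma admissible_abs_summable (R : realType) (Q : {poly int}) (v : nat -> R) (M : nat) :
  Q != 0 -> admissible R Q -> (0 < M)%N ->
  (forall k, shift_act (map_poly intr Q) v k = 0) ->
  exists N, [/\ (0 < N)%N, (M %| N)%N & abs_summable (fun k => v (k + N)%N - v k)].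
Proof.
move=> Q_neq0 admQ M_gt0 annQ; pose QC : {poly R[i]} := map_poly intr Q.
have QC_neq0 : QC != 0 by rewrite map_poly_eq0_id0 // intr_eq0 lead_coef_eq0.
have [rs defQ] := closed_field_poly_normal QC.
have [N [N_gt0 dvd_MN unityN]] := common_unity_exponent rs M_gt0.
exists N; split=> //; pose w k := real_complex R (v k).
have [|k|B leB] := @annihilated_abs_summable _ QC N w QC_neq0.
- move=> a Qa; have [unit_or_small mup_a] := admQ a Qa; split=> [aN|].
    by apply: mup_a; exists N.
  case: unit_or_small => [ua|]; last by right.
  left; apply: unityN => //; move: Qa; rewrite -/QC defQ rootZ ?root_prod_XsubC //.
  by rewrite lead_coef_eq0.
- have -> : QC = map_poly (real_complex R) (map_poly intr Q).
    by rewrite -map_poly_comp; apply: eq_map_poly => i /=; rewrite rmorph_int.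
  by rewrite shift_act_map annQ rmorph0.
exists (complex.Re B) => n; have := leB n.
have -> : \sum_(k < n) `|w (k + N)%N - w k| =
    real_complex R (\sum_(k < n) `|v (k + N)%N - v k|).
  by rewrite rmorph_sum; apply: eq_bigr => k _; rewrite -rmorphB normc_def /= expr0n addr0 sqrtr_sqr.
by case: B {leB} => a b; rewrite lecE => /andP[].
Qed.

(** * Asymptotic periodicity *)

Lemma abs_summable_tail (R : realType) (u : nat -> R) (e : R) :
  abs_summable u -> 0 < e ->
  exists K, forall m n, (K <= m)%N -> \sum_(m <= i < n) `|u i| <= e.
Proof.
move=> [B leB] e_gt0; pose U n := \sum_(i < n) `|u i|.
have supU : has_sup (range U).
  by split; [exists (U 0%N), 0%N | exists B => _ [n _ <-]; exact: leB].
have [_ [K _ <-] ltUK] := sup_adherent e_gt0 supU.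
exists K => m n le_Km; have [le_nm|lt_mn] := leqP n m; first by rewrite big_geq // ltW.
have leU : U n <= sup (range U) by apply: ub_le_sup; [exact: supU.2 | exists n].
have eqU : U n = U K + \sum_(K <= i < m) `|u i| + \sum_(m <= i < n) `|u i|.
  have defU j : U j = \sum_(0 <= i < j) `|u i| by rewrite big_mkord.
  by rewrite !defU -(big_cat_nat (leq0n K)) //= -(big_cat_nat (leq0n m)) // ltnW.
have : 0 <= \sum_(K <= i < m) `|u i| by apply: sumr_ge0.
by lra.
Qed.

(** Telescoping with step [N] uses only the indices [k, k + N, ...], some of those in the range on
    the right. *)
Lemma norm_sub_step_le (R : realType) (v : nat -> R) (N k a : nat) :
  `|v (k + a * N)%N - v k| <= \sum_(k <= i < k + a * N) `|v (i + N)%N - v i|.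
Proof.
have [->|N_gt0] := posnP N.
  by rewrite muln0 addn0 subrr normr0; apply: sumr_ge0.
elim: a => [|a IHa]; first by rewrite addn0 subrr normr0; apply: sumr_ge0.
rewrite mulSnr addnA (@big_cat_nat _ _ _ (k + a * N)) ?leq_addr //=.
rewrite -(subrK (v (k + a * N)%N) (v _)) -addrA addrC.
apply: le_trans (ler_normD _ _) (lerD IHa _).
rewrite big_ltn; last by rewrite -{1}[(k + a * N)%N]addn0 ltn_add2l.
by rewrite lerDl; apply: sumr_ge0.
Qed.

Lemma asymptotically_periodic (R : realType) (v : nat -> R) (N : nat) (e : R) :
  abs_summable (fun k => v (k + N)%N - v k) -> 0 < e ->
  exists K, forall k k', (K <= k)%N -> (K <= k')%N -> (k = k' %[mod N])%N ->
    `|v k - v k'| <= e.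
Proof.
move=> sv e_gt0; have [K tail] := abs_summable_tail sv e_gt0; exists K.
suff close k k' : (K <= k)%N -> (k <= k')%N -> (k = k' %[mod N])%N -> `|v k' - v k| <= e.
  move=> k k' le_k le_k' eq_mod; have [le_kk'|/ltnW le_kk'] := leqP k k'.
    by rewrite distrC; apply: close.
  exact: close.
move=> le_k le_kk' /esym/eqP; rewrite eqn_mod_dvd // => /dvdnP[a def_a].
rewrite -(subnKC le_kk') def_a.
by apply: le_trans (norm_sub_step_le _ _ _ _) (tail _ _ _).
Qed.

(** Each term is compared with the first one of its residue class, [v (k %% N)]. *)
Lemma abs_summable_step_bounded (R : realType) (v : nat -> R) (N : nat) :
  (0 < N)%N -> abs_summable (fun k => v (k + N)%N - v k) ->
  exists B, forall k, `|v k| <= B.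
Proof.
move=> N_gt0 [B leB]; exists (B + \sum_(r < N) `|v r|) => k.
have := norm_sub_step_le v N (k %% N) (k %/ N); rewrite addnC -divn_eq => le_k.
rewrite -(subrK (v (k %% N)%N) (v k)); apply: le_trans (ler_normD _ _) (lerD _ _).
  apply: le_trans le_k _; apply: le_trans (leB k).
  rewrite -[leRHS](big_mkord xpredT (fun i => `|v (i + N)%N - v i|)).
  rewrite [leRHS](@big_cat_nat _ _ _ (k %% N)) ?leq_mod //= lerDr.
  exact: sumr_ge0.
by rewrite (bigD1 (Ordinal (ltn_pmod k N_gt0))) //= lerDl sumr_ge0.
Qed.

(** * Upper and lower limits of bounded sequences *)

(** Boundedness makes the limit defining [limn_sup] exist and equal the infimum of the tail suprema,
    one of which is within [e] of it. *)
Lemma limn_sup_eventually (R : realType) (u : nat -> R) (e : R) :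
  (exists B, forall k, `|u k| <= B) -> 0 < e ->
  exists K, forall k, (K <= k)%N -> u k <= limn_sup u + e.
Proof.
move=> [B leB] e_gt0.
have ubu : has_ubound (range u).
  by exists B => _ [k _ <-]; apply: le_trans (ler_norm _) (leB k).
have lbu : has_lbound (range u).
  by exists (- B) => _ [k _ <-]; rewrite lerNl; apply: le_trans (leB k); rewrite -normrN ler_norm.
have cvg_su := cvg_sups_inf ubu lbu.
rewrite /limn_sup (cvg_lim _ cvg_su) //.
have hi : has_inf (range (sups u)).
  split; first by exists (sups u 0%N), 0%N.
  apply: bounded_fun_has_lbound_sups; exists B; split; first exact: num_real.
  by move=> x /ltW Bx k _ /=; apply: le_trans (leB k) Bx.
have [_ [K _ <-] ltK] := inf_adherent e_gt0 hi.
exists K => k le_Kk; apply: ltW; apply: le_lt_trans ltK.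
apply: ub_le_sup; last by exists k.
by case: ubu => b ub; exists b => _ [j _ <-]; apply: ub; exists j.
Qed.

Lemma limn_inf_eventually (R : realType) (u : nat -> R) (e : R) :
  (exists B, forall k, `|u k| <= B) -> 0 < e ->
  exists K, forall k, (K <= k)%N -> limn_inf u - e <= u k.
Proof.
move=> [B leB] e_gt0.
have [|K leK] := @limn_sup_eventually _ (-%R \o u) e _ e_gt0.
  by exists B => k; rewrite /= normrN.
have ubu : has_ubound (range u).
  by exists B => _ [k _ <-]; apply: le_trans (ler_norm _) (leB k).
have lbu : has_lbound (range u).
  by exists (- B) => _ [k _ <-]; rewrite lerNl; apply: le_trans (leB k); rewrite -normrN ler_norm.
have cvg_iu := cvg_infs_sup ubu lbu.
exists K => k /leK; rewrite /limn_sup supsN (cvg_lim _ (cvgN cvg_iu)) //.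
by rewrite /limn_inf (cvg_lim _ cvg_iu) //= ; lra.
Qed.

(** * Polynomial length and the oscillation inequality *)

Section PolyLength.
Variable R : realType.
Implicit Types (p : {poly R}) (b : R).

Lemma poly_length_ge0 p : 0 <= poly_length p.
Proof. by apply: sumr_ge0. Qed.

Lemma poly_length_gt0 p : p != 0 -> 0 < poly_length p.
Proof.
move=> p_neq0; have szp : (0 < size p)%N by rewrite size_poly_gt0.
have lt_last : ((size p).-1 < size p)%N by rewrite prednK.
rewrite /poly_length (bigD1 (Ordinal lt_last)) //= ltr_wpDr ?sumr_ge0 //.
by rewrite normr_gt0 -/(lead_coef p) lead_coef_eq0.
Qed.

Lemma norm_shift_act_le p (w : nat -> R) (k : nat) b :
  (forall i, `|w (k + i)%N| <= b) -> `|shift_act p w k| <= poly_length p * b.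
Proof.
move=> le_b; apply: le_trans (ler_norm_sum _ _ _) _; rewrite mulr_suml.
by apply: ler_sum => i _; rewrite normrM ler_wpM2l.
Qed.

Lemma norm_shift_act_sub_le p (w : nat -> R) (k k' : nat) b :
  (forall i, `|w (k + i)%N - w (k' + i)%N| <= b) ->
  `|shift_act p w k - shift_act p w k'| <= poly_length p * b.
Proof.
move=> le_b; rewrite shift_act_sub; apply: le_trans (ler_norm_sum _ _ _) _.
rewrite mulr_suml; apply: ler_sum => i _.
by rewrite normrM ler_wpM2l.
Qed.

End PolyLength.

(** Turns a real bound into the natural one from which the finite set of states is built. *)
Lemma bounded_int_seq (R : realType) (g : nat -> int) (b : R) :
  (forall k, `|(g k)%:~R : R| <= b) -> exists B, forall k, (absz (g k) <= B)%N.
Proof.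
move=> le_b; exists (Num.bound `|b|) => k; rewrite -(ler_nat R).
have -> : (absz (g k))%:R = `|(g k)%:~R| :> R by rewrite -intr_norm -abszE.
apply: le_trans (le_b k) _; apply: ltW; apply: le_lt_trans (ler_norm _) _.
exact/archi_boundP.
Qed.

(* With [T] monic or of constant coefficient [1], two windows of the integer sequence
   [S(E) z] (for [E] the shift) that differ only at the matching end have images under
   [T(E)] at distance at least [1], and [S(E) y] has to make up for it. *)
Lemma one_le_length_oscillation (R : realType) (S : {poly int}) (T : {poly R})
    (y : nat -> R) (z : nat -> int) (N K : nat) (b : R) :
  (0 < N)%N -> lead_coef T = 1 \/ T`_0 = 1 ->
  (exists B, forall k, `|y k| <= B) ->
  ~ (exists2 p, (0 < p)%N & exists K', forall k, (K' <= k)%N ->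
       shift_act S z (k + p) = shift_act S z k) ->
  abs_summable (fun k => shift_act (map_poly intr S) (fun j => y j + (z j)%:~R) (k + N)
                         - shift_act (map_poly intr S) (fun j => y j + (z j)%:~R) k : R) ->
  (forall k k', (K <= k)%N -> (K <= k')%N -> (k = k' %[mod N])%N -> `|y k - y k'| <= b) ->
  1 <= poly_length (map_poly intr S * T) * b.
Proof.
set SR := map_poly intr S => N_gt0 T1 [By leBy] aper.
set v := shift_act SR _ => sum_v osc; pose g := shift_act S z.
have defv k : v k = shift_act SR y k + (g k)%:~R.
  by rewrite /v shift_act_seqD /SR shift_act_map.
have [Bv leBv] := abs_summable_step_bounded N_gt0 sum_v.
have [B leB] : exists B, forall k, (absz (g k) <= B)%N.
  apply: (@bounded_int_seq R _ (Bv + poly_length SR * By)) => k.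
  have -> : (g k)%:~R = v k - shift_act SR y k by rewrite defv addrC addKr.
  apply: le_trans (ler_normB _ _) (lerD (leBv k) _).
  by apply: norm_shift_act_le => i; apply: leBy.
have [j jd Tj] : exists2 j, (j = 0 \/ j = (size T).-1)%N & T`_j = 1.
  by case: T1; [exists (size T).-1 => //; right | exists 0%N => //; left].
have szT : (0 < size T)%N.
  rewrite size_poly_gt0; apply/eqP => T0; move: Tj; rewrite T0 coef0.
  by move=> /eqP; rewrite eq_sym oner_eq0.
apply/ler_addgt0Pr => e e_gt0.
(* Applying [T(E)] multiplies this tolerance by at most the length of [T], which leaves less than
   [e]. *)
have e'_gt0 : 0 < e / (poly_length T + 1).
  by rewrite divr_gt0 // ltr_wpDl ?poly_length_ge0.
have [Kv close] := asymptotically_periodic sum_v e'_gt0.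
have [k [k' [le_k le_k' eq_mod win neq]]] :=
  aperiodic_discrepancy (maxn K Kv) N_gt0 jd leB aper.
pose gR n : R := (g n)%:~R.
have eq_g : shift_act T gR k - shift_act T gR k' = gR (k + j)%N - gR (k' + j)%N.
  have lt_j : (j < size T)%N by case: jd => ->; rewrite ?prednK.
  rewrite shift_act_sub (bigD1 (Ordinal lt_j)) //= Tj mul1r big1 ?addr0 // => i neq_i.
  rewrite /gR win ?subrr ?mulr0 //; first by rewrite -ltnS prednK.
have ge1 : 1 <= `|shift_act T gR k - shift_act T gR k'|.
  rewrite eq_g /gR -rmorphB -intr_norm -[1]/(1%:~R) ler_int.
  by rewrite -gtz0_ge1 normr_gt0 subr_eq0.
have eq_mod_i i : (k + i = k' + i %[mod N])%N by rewrite -modnDml eq_mod modnDml.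
have eq_T n : shift_act T gR n = shift_act T v n - shift_act (SR * T) y n.
  rewrite mulrC shift_actM shift_act_sub; apply: eq_bigr => i _.
  by rewrite defv [X in X - _]addrC addrK.
apply: le_trans ge1 _; rewrite !eq_T.
(* The gap of at least 1 splits into a variation of [T(E) v], at most [e], and one of [(S T)(E) y],
   controlled by [b]. *)
rewrite (_ : _ - _ - _ = (shift_act T v k - shift_act T v k') -
  (shift_act (SR * T) y k - shift_act (SR * T) y k')); last by ring.
apply: le_trans (ler_normB _ _) _; rewrite addrC; apply: lerD.
  apply: norm_shift_act_sub_le => i; apply: osc => //; move: le_k le_k'; rewrite !geq_max; lia.
apply: (@le_trans _ _ (poly_length T * (e / (poly_length T + 1)))).
  apply: norm_shift_act_sub_le => i; apply: close => //; move: le_k le_k'; rewrite !geq_max; lia.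
rewrite mulrA ler_pdivrMr; last by rewrite ltr_wpDl ?poly_length_ge0.
by rewrite mulrC ler_pM2l // lerDl.
Qed.

(** * Linear recurrent sequences *)

(** The factor ['X^K] delays the recurrence past [K]; low coefficients may be zero. *)
Lemma linear_recurrent_of_annihilated (R : realType) (A : {poly int}) (z : nat -> int)
    (K : nat) :
  A != 0 -> (forall k, (K <= k)%N -> shift_act A z k = 0) ->
  linear_recurrent (fun k => (z k)%:~R : R).
Proof.
move=> A_neq0 annA; exists ('X^K * A); first by rewrite mulf_neq0 // monic_neq0 // monicXn.
move=> k _; transitivity ((shift_act ('X^K * A) z k)%:~R : R).
  by rewrite rmorph_sum; apply: eq_bigr => i _; rewrite rmorphM.
by rewrite shift_actM shift_actXn annA ?leq_addl.
Qed.

(** A period [p] of [S(E) z] would make [('X^p - 1) * S] annihilate [z] from some index on. *)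
Lemma not_eventually_periodic (R : realType) (S : {poly int}) (z : nat -> int) :
  S != 0 -> ~ linear_recurrent (fun k => (z k)%:~R : R) ->
  ~ (exists2 p, (0 < p)%N & exists K, forall k, (K <= k)%N ->
       shift_act S z (k + p) = shift_act S z k).
Proof.
move=> S_neq0 nrec [p p_gt0 [K per]]; apply: nrec.
apply: (@linear_recurrent_of_annihilated _ (('X^p - 1) * S) z K).
  by rewrite mulf_neq0 // monic_neq0 // monicXnsubC.
by move=> k le_k; rewrite shift_actM shift_actB1 per // subrr.
Qed.

(** Reindexes from 1 to 0, where [shift_act] needs no side condition. *)
Lemma recurrence_byP (R : realType) (A : {poly int}) (w : nat -> R) :
  recurrence_by A w <->
  forall k, shift_act (map_poly intr A) (fun j => w (1 + j)%N) k = 0.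
Proof.
have eqA k : shift_act (map_poly intr A) (fun j => w (1 + j)%N) k =
    \sum_(i < size A) (A`_i)%:~R * w (k.+1 + i)%N.
  rewrite (@shift_act_widen _ _ _ _ (size A)) ?size_poly //.
  by apply: eq_bigr => i _; rewrite coef_map.
split=> [rec k|rec [//|k] _]; first by rewrite eqA rec.
by rewrite -eqA rec.
Qed.

(** * From residue classes to [lambda] *)

Lemma residue_oscillation (R : realType) (M : nat) (y : nat -> R) (m e : R) :
  (0 < M)%N -> 0 < e -> (exists B, forall k, `|y k| <= B) ->
  (forall r, (r < M)%N ->
     limn_sup (fun k => y (k * M + r)%N) - limn_inf (fun k => y (k * M + r)%N) <= m) ->
  exists K, forall k k', (K <= k)%N -> (K <= k')%N -> (k = k' %[mod M])%N ->
    `|y k - y k'| <= m + e.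
Proof.
move=> M_gt0 e_gt0 [B leB] osc_le; have e2_gt0 : 0 < e / 2 by rewrite divr_gt0.
have bnd (r : 'I_M) : exists B', forall k, `|y (k * M + r)%N| <= B' by exists B => k.
have /choice[Ks KsP] (r : 'I_M) := limn_sup_eventually (bnd r) e2_gt0.
have /choice[Ki KiP] (r : 'I_M) := limn_inf_eventually (bnd r) e2_gt0.
(* Beyond this index the quotient by [M] exceeds the thresholds of every residue class. *)
exists ((\max_r Ks r + \max_r Ki r) * M)%N => k k'; rewrite -!leq_divRL // => le_k le_k' eq_mod.
pose r := Ordinal (ltn_pmod k M_gt0).
have div_r n : (n %% M = r)%N -> (n %/ M * M + r)%N = n by move=> <-; rewrite -divn_eq.
have leKs : (Ks r <= \max_r Ks r)%N by apply: (@leq_bigmax _ Ks).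
have leKi : (Ki r <= \max_r Ki r)%N by apply: (@leq_bigmax _ Ki).
have bounds n : (\max_r Ks r + \max_r Ki r <= n %/ M)%N -> (n %% M = r)%N ->
    limn_inf (fun k => y (k * M + r)%N) - e / 2 <= y n <=
    limn_sup (fun k => y (k * M + r)%N) + e / 2.
  move=> le_n mod_n; rewrite -(div_r n mod_n).
  by apply/andP; split; [apply: KiP | apply: KsP]; lia.
have /andP[lk uk] := bounds k le_k erefl.
have /andP[lk' uk'] := bounds k' le_k' (esym eq_mod).
have := osc_le r (ltn_ord r).
by rewrite ler_norml => ?; apply/andP; split; lra.
Qed.

(** As [M] divides the asymptotic period [N], the oscillation bound modulo [M] also serves modulo
    [N]. *)
Lemma one_le_length_mul (R : realType) (Q S : {poly int}) (T : {poly R})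
    (y : nat -> R) (z : nat -> int) (M K : nat) (b : R) :
  Q * S != 0 -> admissible R Q -> lead_coef T = 1 \/ T`_0 = 1 -> (0 < M)%N ->
  (exists B, forall k, `|y k| <= B) ->
  (forall k, shift_act (map_poly intr (Q * S)) (fun j => y j + (z j)%:~R) k = 0) ->
  ~ linear_recurrent (fun k => (z k)%:~R : R) ->
  (forall k k', (K <= k)%N -> (K <= k')%N -> (k = k' %[mod M])%N -> `|y k - y k'| <= b) ->
  1 <= poly_length (map_poly intr S * T) * b.
Proof.
rewrite mulf_eq0 negb_or => /andP[Q_neq0 S_neq0] admQ T1 M_gt0 bnd_y rec nrec osc.
pose v := shift_act (map_poly intr S) (fun j => y j + (z j)%:~R).
have annQ k : shift_act (map_poly intr Q) v k = 0.
  by rewrite -shift_actM -rmorphM.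
have [N [N_gt0 dvd_MN sum_v]] := admissible_abs_summable Q_neq0 admQ M_gt0 annQ.
apply: (@one_le_length_oscillation _ _ _ y z N K) => //.
  exact: not_eventually_periodic nrec.
move=> k k' le_k le_k' eq_mod; apply: osc => //.
by rewrite -(modn_dvdm k dvd_MN) eq_mod modn_dvdm.
Qed.

(** All the lengths involved are at least [1 / b], and this passes through both infima, taken over
    nonempty sets; inverting needs [b > 0]. *)
Lemma inv_lambda_le (R : realType) (P : {poly int}) (b : R) :
  (forall Q S T, P = Q * S -> admissible R Q -> lead_coef T = 1 \/ T`_0 = 1 ->
     1 <= poly_length (map_poly intr S * T) * b) ->
  1 / lambda R P <= b.
Proof.
move=> le1.
have adm1 : admissible R 1.
  by move=> a; rewrite rmorph1 /root hornerC oner_eq0.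
(* The trivial choice [Q = T = 1] already excludes [b <= 0], lengths being nonnegative. *)
have b_gt0 : 0 < b.
  rewrite ltNge; apply/negP => b_le0.
  have := le1 1 P 1 (esym (mul1r P)) adm1 (or_introl (lead_coef1 _)).
  by apply/negP; rewrite -ltNge (le_lt_trans _ ltr01) // mulr_ge0_le0 // poly_length_ge0.
have inv_b_le : 1 / b <= lambda R P.
  apply: lb_le_inf; first by exists (reduced_length (map_poly intr P)), P => //; exists 1; rewrite ?mul1r.
  move=> _ [S [Q defP admQ] <-]; apply: lb_le_inf.
    by exists (poly_length (map_poly intr S * 1)), 1 => //; left; rewrite lead_coef1.
  by move=> _ [T T1 <-]; rewrite ler_pdivrMr //; apply: le1 defP admQ T1.
rewrite ler_pdivrMr; last by apply: lt_le_trans inv_b_le; rewrite divr_gt0.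
by rewrite mulrC -ler_pdivrMr.
Qed.

(** * The two lower bounds *)

Lemma linear_recurrent_shift (R : realType) (w : nat -> R) (n : nat) :
  linear_recurrent (fun k => w (n + k)%N) -> linear_recurrent w.
Proof.
move=> [A A_neq0 /recurrence_byP recA]; exists ('X^n * A).
  by rewrite mulf_neq0 // monic_neq0 // monicXn.
apply/recurrence_byP => k; rewrite rmorphM /= map_polyXn shift_actM shift_actXn.
rewrite -(recA k) addnC -shift_act_shift; apply: eq_shift_act => j.
by congr w; lia.
Qed.

(* The index [k * M + l] is an integer; it is nonnegative, hence equal to its
   absolute value, for all large [k], and only these matter. *)
Theorem theorem1p8 (R : realType) (P : {poly int}) (x y : nat -> R)
    (z : nat -> int) :
  P != 0 ->
  recurrence_by P x ->
  (forall k : nat, (0 < k)%N -> x k = y k + (z k)%:~R) ->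
  [bounded y k | k in [set k : nat | (0 < k)%N]] ->
  ~ linear_recurrent (fun k => (z k)%:~R : R) ->
  1 / poly_length (map_poly intr P : {poly R}) <= limn_sup (fun k => `|y k|) /\
  forall M : nat, (0 < M)%N -> exists l : int,
    1 / lambda R P <=
      limn_sup (fun k : nat => y (absz (k%:Z * M%:Z + l))) -
      limn_inf (fun k : nat => y (absz (k%:Z * M%:Z + l))).
Proof.
move=> P_neq0 /recurrence_byP rec_x defx [B0 [_ bndB0]] nrec_z.
have bnd_y : exists B, forall k, `|y k| <= B.
  (* Boundedness gives every bound above [B0], hence [B0 + 1]; the unconstrained value at index 0 is
     added by hand. *)
  exists (Num.max (B0 + 1) `|y 0%N|) => -[|k]; rewrite le_max ?lexx ?orbT //.
  by rewrite bndB0 // ltrDl.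
pose y' k := y (1 + k)%N; pose z' k := z (1 + k)%N.
have bnd_y' : exists B, forall k, `|y' k| <= B.
  by have [B leB] := bnd_y; exists B => k; apply: leB.
have rec k : shift_act (map_poly intr P) (fun j => y' j + (z' j)%:~R) k = 0.
  by rewrite -[RHS](rec_x k); apply: eq_shift_act => j; rewrite defx.
have nrec : ~ linear_recurrent (fun k => (z' k)%:~R : R).
  by move/(@linear_recurrent_shift _ (fun k => (z k)%:~R) 1).
set PR : {poly R} := map_poly intr P in rec *.
have L_gt0 : 0 < poly_length PR.
  by rewrite poly_length_gt0 // map_poly_eq0_id0 // intr_eq0 lead_coef_eq0.
split=> [|M M_gt0].
  (* Otherwise the integer [P(E) z' = - P(E) y'] is eventually less than 1 in absolute value, hence
     zero, and [z'] is recurrent. *)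
  rewrite leNgt; apply/negP => lt_sup; apply: nrec.
  pose e := (1 / poly_length PR - limn_sup (fun k => `|y k|)) / 2.
  have e_gt0 : 0 < e by rewrite /e; lra.
  have [|K leK] := @limn_sup_eventually _ (fun k => `|y k|) e _ e_gt0.
    by have [B leB] := bnd_y; exists B => k; rewrite normr_id.
  apply: (@linear_recurrent_of_annihilated _ P _ K) => // k le_k.
  suff : `|shift_act P z' k| < 1 by lia.
  rewrite -(ltr_int R) intr_norm.
  have -> : (shift_act P z' k)%:~R = - shift_act PR y' k.
    by apply/eqP; rewrite -addr_eq0 addrC -(shift_act_map intr) -shift_act_seqD rec.
  rewrite normrN -(mulVf (lt0r_neq0 L_gt0)) mulrC.
  have lt_b : limn_sup (fun k => `|y k|) + e < (poly_length PR)^-1 by rewrite /e; lra.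
  apply: le_lt_trans (norm_shift_act_le _ _) _; last by rewrite ltr_pM2l //; exact: lt_b.
  by move=> i; apply: leK; lia.
pose osc r := limn_sup (fun k => y' (k * M + r)%N) - limn_inf (fun k => y' (k * M + r)%N).
(* The class of largest oscillation bounds all the others, so a single [l] is enough. *)
pose r := [arg max_(i > Ordinal M_gt0) osc i]%O.
have osc_le i : (i < M)%N -> osc i <= osc r.
  move=> lt_iM; rewrite /r; case: arg_maxP => // j _ /(_ (Ordinal lt_iM)).
  exact.
(* The extra 1 undoes the reindexing in [y']. *)
exists (r.+1)%:Z.
rewrite (_ : (fun k => y (absz _)) = (fun k => y' (k * M + r)%N)); last first.
  by apply/funext => k; congr y; lia.
apply/ler_addgt0Pr => e e_gt0.
have [K osc_y'] := residue_oscillation M_gt0 e_gt0 bnd_y' osc_le.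
apply: inv_lambda_le => Q S T defP admQ T1.
by apply: (@one_le_length_mul _ Q S T y' z' M K) => //; rewrite -?defP.
Qed.
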